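(* Let $(\mathfrak{A}_q,[\cdot,\cdot]_q,\alpha_q)$ be the $q$-deformed Heisenberg-Virasoro superalgebra of Hom-type. If $D$ is an $\alpha$-derivation (that is, an $\alpha^1$-derivation with $\alpha=\alpha_q$) of $\mathfrak{A}_q$, then $D=0$.
   Context: Let $q\in\mathbb{C}\setminus\{0,1\}$ and $\{n\}=\frac{1-q^n}{1-q}$ for $n\in\mathbb{Z}$. $\mathfrak{A}_q$ is the complex superspace with basis $\{L_m,I_m\mid m\in\mathbb{Z}\}$ of parity $0$ and $\{G_m,T_m\mid m\in\mathbb{Z}\}$ of parity $1$, with super-skew-symmetric bracket ($[x,y]_q=-(-1)^{|x||y|}[y,x]_q$) determined by $[L_m,L_n]_q=(\{m\}-\{n\})L_{m+n}$, $[L_m,I_n]_q=-\{n\}I_{m+n}$, $[L_m,G_n]_q=(\{m\}-\{n+1\})G_{m+n}$, $[I_m,G_n]_q=\{m\}T_{m+n}$, $[L_m,T_n]_q=-\{n+1\}T_{m+n}$, and $[I_m,I_n]_q=[I_m,T_n]_q=[T_m,G_n]_q=[T_m,T_n]_q=[G_m,G_n]_q=0$; the twist is the even linear map $\alpha=\alpha_q$ with $\alpha_q(L_n)=(1+q^n)L_n$, $\alpha_q(I_n)=(1+q^n)I_n$, $\alpha_q(G_n)=(1+q^{n+1})G_n$, $\alpha_q(T_n)=(1+q^{n+1})T_n$. Derivations are taken homogeneous for the parity and for the $\mathbb{Z}$-degree: $D$ has degree $s\in\mathbb{Z}$ if, for all $n$, an even $D$ maps $\mathrm{span}(L_n,I_n)$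 into $\mathrm{span}(L_{n+s},I_{n+s})$ and $\mathrm{span}(G_n,T_n)$ into $\mathrm{span}(G_{n+s},T_{n+s})$, while an odd $D$ maps $\mathrm{span}(L_n,I_n)$ into $\mathrm{span}(G_{n+s},T_{n+s})$ and $\mathrm{span}(G_n,T_n)$ into $\mathrm{span}(L_{n+s},I_{n+s})$. A homogeneous linear map $D:\mathfrak{A}_q\to\mathfrak{A}_q$ of parity $|D|$ is an $\alpha^k$-derivation ($k\ge0$) if $D([x,y]_q)=[D(x),\alpha^k(y)]_q+(-1)^{|x||D|}[\alpha^k(x),D(y)]_q$ for all homogeneous $x,y$. The space of all $\alpha^k$-derivations is regarded as the direct sum of its homogeneous (parity and degree) components.
   Formalization: The case q = -1 is excluded: there the claim fails, since the map L_n ↦ I_n for even n, zero on all other basis vectors, is a nonzero even α-derivation of degree 0. *)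

(* Defs.v *)
From HB Require Import structures.
From mathcomp Require Import all_boot all_order all_algebra.
From mathcomp Require Import zify.
From mathcomp Require Export reals complex.
From mathcomp.multinomials Require Export freeg.

Set Implicit Arguments.
Unset Strict Implicit.
Unset Printing Implicit Defensive.

Import GRing.Theory.

Local Open Scope ring_scope.

Inductive hv_basis : Type :=
  | hvL of int | hvI of int | hvG of int | hvT of int.

Definition parity (b : hv_basis) : bool :=
  match b with hvL _ | hvI _ => false | hvG _ | hvT _ => true end.

Definition degree (b : hv_basis) : int :=
  match b with hvL n | hvI n | hvG n | hvT n => n end.

Definition hv_encode (b : hv_basis) : bool * bool * int :=
  match b with
  | hvL n => (false, false, n) | hvI n => (false, true, n)
  | hvG n => (true, false, n) | hvT n => (true, true, n)
  end.

Definition hv_decode (c : bool * bool * int) : hv_basis :=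
  match c with
  | (false, false, n) => hvL n | (false, true, n) => hvI n
  | (true, false, n) => hvG n | (true, true, n) => hvT n
  end.

Lemma hv_encodeK : cancel hv_encode hv_decode.
Proof. by case. Qed.

HB.instance Definition _ := Choice.copy hv_basis (can_type hv_encodeK).

Notation hv K := {freeg hv_basis / K}.

Section HeisenbergVirasoro.
Variables (K : fieldType) (q : K).
Implicit Types (x y : hv K) (p d : bool) (n s : int) (k : nat).

Definition qnum n : K := (1 - q ^ n) / (1 - q).

(* The rows after [L_m, T_n] are those forced by super-skew-symmetry: the sign
   is -1 in each of them, one of the two arguments being even. *)
Definition bracket_basis (a b : hv_basis) : hv K :=
  match a, b with
  | hvL m, hvL n => << qnum m - qnum n *g hvL (m + n) >>
  | hvL m, hvI n => << - qnum n *g hvI (m + n) >>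
  | hvL m, hvG n => << qnum m - qnum (n + 1) *g hvG (m + n) >>
  | hvI m, hvG n => << qnum m *g hvT (m + n) >>
  | hvL m, hvT n => << - qnum (n + 1) *g hvT (m + n) >>
  | hvI n, hvL m => - << - qnum n *g hvI (m + n) >>
  | hvG n, hvL m => - << qnum m - qnum (n + 1) *g hvG (m + n) >>
  | hvG n, hvI m => - << qnum m *g hvT (m + n) >>
  | hvT n, hvL m => - << - qnum (n + 1) *g hvT (m + n) >>
  | _, _ => 0
  end.

(* [fglift] is linear extension from the basis. *)
Definition bracket x y : hv K :=
  fglift (fun a => fglift (fun b => bracket_basis a b) y) x.

Definition alpha : hv K -> hv K :=
  fglift (fun b => << 1 + q ^ (degree b + (parity b)%:Z) *g b >>).

Definition has_parity p x : Prop :=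
  forall b, b \in dom x -> parity b = p.

(* span(L_n, I_n) for p = false, span(G_n, T_n) for p = true *)
Definition component p n x : Prop :=
  forall b, b \in dom x -> parity b = p /\ degree b = n.

Definition homogeneous_map d s (D : {linear hv K -> hv K}) : Prop :=
  forall p n x, component p n x -> component (p (+) d) (n + s) (D x).

Definition homogeneous_alpha_derivation k d s
    (D : {linear hv K -> hv K}) : Prop :=
  homogeneous_map d s D /\
  forall (px py : bool) x y, has_parity px x -> has_parity py y ->
    D (bracket x y) =
      bracket (D x) (iter k alpha y)
      + (-1) ^+ (px * d) *: bracket (iter k alpha x) (D y).

(* An element of the direct sum, over (parity, degree), of the spaces of
   homogeneous alpha^k-derivations. *)
Definition alpha_derivation k (D : {linear hv K -> hv K}) : Prop :=
  exists (r : seq (bool * int))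
         (Dc : bool * int -> {linear hv K -> hv K}),
    [/\ uniq r,
        forall c, c \in r -> homogeneous_alpha_derivation k c.1 c.2 (Dc c)
      & forall x, D x = \sum_(c <- r) Dc c x].

Lemma fglift_is_zmod_morphism (f : hv_basis -> hv K) :
  zmod_morphism (fglift f).
Proof. exact: lift_is_additive. Qed.

HB.instance Definition _ (f : hv_basis -> hv K) :=
  GRing.isZmodMorphism.Build (hv K) (hv K) (fglift f)
    (fglift_is_zmod_morphism f).

Lemma fglift_is_scalable (f : hv_basis -> hv K) : scalable (fglift f).
Proof.
move=> c x; rewrite -[in RHS](freeg_sumE x) -[c *: x]/(fgscale c x) /fgscale.
rewrite !raddf_sum; apply: eq_bigr => b _ /=.
by rewrite !liftU scalerA.
Qed.

HB.instance Definition _ (f : hv_basis -> hv K) :=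
  GRing.isScalable.Build K (hv K) (hv K) *:%R (fglift f)
    (fglift_is_scalable f).

End HeisenbergVirasoro.

(* The vanishing of all alpha-derivations fails at q = -1, although q is neither
   0 nor 1 there: the map L_n |-> I_n for even n, sending every other basis
   vector to 0, is a nonzero even alpha-derivation of degree 0. *)
Definition DN1_basis (K : fieldType) (b : hv_basis) : hv K :=
  if b is hvL n then << (~~ odd `|n|)%:R *g hvI n >> else 0.

Definition DN1 (K : fieldType) : {linear hv K -> hv K} :=
  fglift (@DN1_basis K).

Lemma exprzN1 (K : fieldType) (n : int) : (-1 : K) ^ n = (-1) ^+ odd `|n|.
Proof.
case: n => n; first by rewrite -exprnP signr_odd.
by rewrite NegzE -exprz_inv invrN1 -exprnP abszN absz_nat signr_odd.
Qed.

Lemma qnumN1 (K : fieldType) (n : int) :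
  (1 : K) != -1 -> qnum (-1 : K) n = (odd `|n|)%:R.
Proof.
move=> neqN1; rewrite /qnum exprzN1; case: odd.
  by rewrite expr1 divff // subr_eq0.
by rewrite expr0 subrr mul0r.
Qed.

Lemma bracketDl (K : fieldType) (q : K) (x1 x2 y : hv K) :
  bracket q (x1 + x2) y = bracket q x1 y + bracket q x2 y.
Proof. by rewrite /bracket raddfD. Qed.

Lemma bracketDr (K : fieldType) (q : K) (x y1 y2 : hv K) :
  bracket q x (y1 + y2) = bracket q x y1 + bracket q x y2.
Proof.
rewrite /bracket -[x]freeg_sumE !raddf_sum -big_split; apply: eq_bigr => a _ /=.
by rewrite !liftU raddfD scalerDr.
Qed.

Lemma bracket0l (K : fieldType) (q : K) (y : hv K) : bracket q 0 y = 0.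
Proof. by rewrite /bracket raddf0. Qed.

Lemma bracket0r (K : fieldType) (q : K) (x : hv K) : bracket q x 0 = 0.
Proof. by apply: (addrI (bracket q x 0)); rewrite -bracketDr !addr0. Qed.

Lemma bracketU (K : fieldType) (q c d : K) (a b : hv_basis) :
  bracket q << c *g a >> << d *g b >> = (c * d) *: bracket_basis q a b.
Proof. by rewrite /bracket !liftU scalerA. Qed.

Lemma freegZU (K : fieldType) (c d : K) (b : hv_basis) :
  c *: << d *g b >> = << c * d *g b >> :> hv K.
Proof. by apply/eqP/freeg_eqP => a; rewrite coeffZ !coeffU mulrA. Qed.

Lemma alpha_derivation_N1_neq0 (K : fieldType) : (1 : K) != -1 ->
  exists D : {linear hv K -> hv K},
    alpha_derivation (-1) 1 D /\ exists x, D x != 0.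
Proof.
move=> neqN1.
have DU c a : DN1 K << c *g a >> = c *: DN1_basis K a by exact: liftU.
have alphaU c a : alpha (-1) << c *g a >> =
    << c * (1 + (-1) ^ (degree a + (parity a)%:Z)) *g a >> :> hv K.
  by rewrite /alpha liftU freegZU.
have bb c d a b :
    DN1 K (bracket (-1) << c *g a >> << d *g b >>) =
    bracket (-1) (DN1 K << c *g a >>) (alpha (-1) << d *g b >>)
    + bracket (-1) (alpha (-1) << c *g a >>) (DN1 K << d *g b >>).
  have odd_abszD (m n : int) : odd `|m + n| = odd `|m| (+) odd `|n| by lia.
  move: (DN1 K) DU => D DU; rewrite !DU !alphaU !bracketU linearZ.
  case: a => m; case: b => n;
    rewrite /= ?raddfN ?raddf0 ?DU /= ?freegZU ?bracket0l ?bracket0r;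
    rewrite ?bracketU ?scaler0 ?oppr0 ?addr0 ?add0r //=;
    rewrite ?exprzN1 ?qnumN1 // ?odd_abszD /= ?(addrC n m);
    case: (odd `|m|); case: (odd `|n|);
    rewrite /= ?(expr0, expr1, subrr, subr0, sub0r, addNr, mulr0, mul0r);
    rewrite ?(raddf0, DU, oppr0, freegU0, scaler0, scale0r, addr0, add0r);
    rewrite ?subrr //.
exists (DN1 K); split; last first.
  exists << hvL 0 >>; rewrite DU scale1r /= freegU_eq0; exact: oner_neq0.
exists [:: (false, 0)], (fun=> DN1 K); split=> //; last first.
  by move=> x; rewrite big_seq1.
move=> c; rewrite inE => /eqP-> /=; split.
  move=> p n x xpn b; rewrite addbF addr0 -[x in DN1 K x]freeg_sumE raddf_sum.
  rewrite mem_dom raddf_sum /=.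
  case: (boolP (has (fun a => coeff b (DN1 K << coeff a x *g a >>) != 0)
                 (dom x))) => [/hasP[a ax +] _|/hasPn x0].
    have [<- <-] := xpn a ax; rewrite DU coeffZ; case: a {ax} => m;
      rewrite /= ?coeff0 ?mulr0 ?eqxx // coeffU.
    by case: (hvI m =P b) => [<- //|_]; rewrite !mulr0 eqxx.
  by rewrite big_seq big1 ?eqxx // => a /x0; rewrite negbK => /eqP.
move=> px py x y _ _; rewrite muln0 expr0 scale1r /=.
elim/freeg_ind_dom0: x => [|c1 a x _ _ IHx].
  by rewrite /alpha !(raddf0, bracket0l) addr0.
rewrite bracketDl [alpha _ (_ + x)]raddfD !raddfD !bracketDl /= IHx [RHS]addrACA.
congr (_ + _); elim/freeg_ind_dom0: y {IHx} => [|c2 b y _ _ IHy].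
  by rewrite [alpha _ 0]raddf0 !(raddf0, bracket0r) addr0.
rewrite bracketDr [alpha _ (_ + y)]raddfD !raddfD !bracketDr /= IHy bb.
by rewrite [RHS]addrACA.
Qed.

(* Main.v *)
Require Import Defs.
From mathcomp Require Import all_boot all_order all_algebra.
From mathcomp Require Import ring.

Set Implicit Arguments.
Unset Strict Implicit.
Unset Printing Implicit Defensive.

Import GRing.Theory Num.Theory.

Local Open Scope ring_scope.

(** The even part, spanned by the L_m and I_m, acts on both halves of the
superalgebra by the same formulas. Write X_n, Y_n for L_n, I_n in the even half
(p = 0) and for G_n, T_n in the odd half (p = 1). Then, with {n} the q-number,
  [L_m, X_n] = ({m} - {n+p}) X_(m+n),   [L_m, Y_n] = - {n+p} Y_(m+n),
  [I_m, X_n] = {m} Y_(m+n),             [I_m, Y_n] = 0,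
and the twist multiplies X_n and Y_n by 1 + q^(n+p). A homogeneous derivation D
is therefore given, on each half, by four scalar sequences, and even and odd D
lead to the same equations: the parity of D only shifts S below.

Put x = q^m, y = q^n and S = q^(s+|D|), where s is the degree. Applying D to
[L_m, L_n] shows that the X- and the Y-coefficient u of D L_n satisfy
  (y - x) u_(m+n) = (1+x) (y S - x^e) u_n - (1+y) (x S - y^e) u_m
with e = 1 and e = 0 respectively. By [cocycle_eq0], such a u vanishes as soon
as u_0 does. For e = 0, u_0 = 0 follows from the equation at the indices -1, 0
and 1 alone ([cocycleY_eq0]); for e = 1 one adds the equation of [L_m, I_n]
([cocycleX_eq0]). The coefficients of D I_n and of D G_n, by the brackets
[L_m, I_n] and then [L_m, G_n], satisfy one-term recurrences whose right-hand
side involves the value at n only, and [recurrence_eq0] disposes of these.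
Finally [I_1, G_(n-1)] = T_n gives D T_n = 0.

No genericity of q is available: q may be a root of unity, so y can be 1, or
1 + y can be 0, for some n. The arguments take the equation at m = 0, which
reads (1 + y - 2 y S) u_n = 0 when u_0 = 0 and so confines the support of u to
a single value of y, and then compare with a few explicit indices. *)

(** * Linear combinations and inverses in a field *)

Section Field.
Variable K : fieldType.
Implicit Types x y k a b : K.

(** Certificates: an equation is deduced from others by exhibiting the
coefficients of a linear combination, which leaves an identity of rational
functions to be checked. *)
Lemma eq_lin1 k1 a1 b1 x y : a1 = b1 -> x - y = k1 * (a1 - b1) -> x = y.
Proof. by move=> -> /eqP; rewrite subrr mulr0 subr_eq0 => /eqP. Qed.

Lemma eq_lin2 k1 k2 a1 b1 a2 b2 x y :
  a1 = b1 -> a2 = b2 -> x - y = k1 * (a1 - b1) + k2 * (a2 - b2) -> x = y.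
Proof. by move=> /eq_lin1 + -> H; apply; rewrite H subrr mulr0 addr0. Qed.

Lemma eq_lin3 k1 k2 k3 a1 b1 a2 b2 a3 b3 x y :
    a1 = b1 -> a2 = b2 -> a3 = b3 ->
  x - y = k1 * (a1 - b1) + k2 * (a2 - b2) + k3 * (a3 - b3) -> x = y.
Proof. by move=> /eq_lin2 H /H + -> E; apply; rewrite E subrr mulr0 addr0. Qed.

Lemma neq_inv x : x != 0 -> x != 1 -> 1 + x != 0 -> x != x^-1.
Proof.
move=> x0 x1 xN1; apply/eqP=> xV; have : (x - 1) * (1 + x) = 0.
  have : x * x = 1 by rewrite {2}xV divff.
  by move=> H; apply: (eq_lin1 (k1 := 1) H); ring.
by apply/eqP; rewrite mulf_neq0 // subr_eq0.
Qed.

Lemma add1V_neq0 x : x != 0 -> 1 + x != 0 -> 1 + x^-1 != 0.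
Proof.
move=> x0 xN1; rewrite -(inj_eq (mulfI x0)) mulrDr mulr1 divff //.
by rewrite mulr0 addrC.
Qed.

End Field.

(** * Scalar recurrences over the powers of q *)

Section Recurrences.
Variables (K : numFieldType) (q S : K).
Hypotheses (q_neq0 : q != 0) (q_neq1 : q != 1) (q_neqN1 : 1 + q != 0).
Hypothesis S_neq0 : S != 0.

(** At m = 0 the recurrence says that u lives where z (2 S - 1) = 1, with
z = t q^n. This fixes z, so u_n <> 0 forces u_(n+1) = u_(n-1) = 0, and the
recurrence at m = 1 and m = -1 gives z S = q^dlt = q^(-dlt). As q <> 1/q, only
dlt = 0 and z = S = 1 survives; there, u_n is reached from u_(n-1) = 0. The
flags eps, for the source, and dlt, for the target, tell the action on the X_n
(flag 1) from that on the Y_n (flag 0); t is q on the odd half, where the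
weights are shifted by 1, and 1 on the even half. *)
Lemma recurrence_eq0 (t : K) (eps dlt : bool) (u : int -> K) : t != 0 ->
    (forall m n, (t * q ^ n - (q ^ m) ^+ eps) * u (m + n) =
                 (1 + q ^ m) * (t * q ^ n * S - (q ^ m) ^+ dlt) * u n) ->
  forall n, u n = 0.
Proof.
move=> t_neq0 recu.
have supp n : u n != 0 -> t * q ^ n * (2 * S - 1) = 1.
  move=> /mulIf; apply; have := recu 0 n; rewrite add0r expr0z !expr1n => H.
  by apply: (eq_lin1 (k1 := -1) H); ring.
have step n m : q ^ m != 1 -> 1 + q ^ m != 0 -> u n != 0 ->
    u (m + n) = 0 /\ t * q ^ n * S = (q ^ m) ^+ dlt.
  move=> x_neq1 x_neqN1 un; have z1 := supp n un.
  have umn : u (m + n) = 0.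
    apply/eqP/contraT=> /supp; rewrite expfzDr // => z2; case/negP: x_neq1.
    by apply/eqP/(eq_lin2 (k1 := 1) (k2 := - q ^ m) z2 z1); ring.
  split=> //; have /eqP := recu m n; rewrite umn mulr0 eq_sym !mulf_eq0.
  by rewrite (negbTE x_neqN1) (negbTE un) orbF subr_eq0 => /eqP.
move=> n; apply/eqP/contraT=> un.
have [] := step n 1 _ _ un; rewrite ?expr1z //.
move=> _; rewrite -(expr1z q); have [] := step n (-1) _ _ un.
- by rewrite exprN1 invr_eq1.
- by rewrite exprN1 add1V_neq0.
rewrite expr1z exprN1 => un1 zV zq; have qV := neq_inv q_neq0 q_neq1 q_neqN1.
case: dlt {recu step} zV zq (recu 1 (-1 + n)) => [|zV _].
  by rewrite !expr1 => -> /esym qV' _; case/eqP: qV.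
rewrite un1 mulr0 addrA subrr add0r expfzDr // exprN1 expr1z => /eqP.
have z1 : t * q ^ n = 1.
  by have := supp n un => H; apply: (eq_lin2 (k1:=2) (k2:=-1) zV H); ring.
rewrite mulrCA z1 mulr1 mulf_eq0 (negbTE un) orbF subr_eq0 eq_sym.
by case: eps; rewrite /= ?(negbTE qV) // eq_sym invr_eq1 (negbTE q_neq1).
Qed.

(** The equation that [L_m, L_n] imposes on the X-coefficient (dlt = 1) or on
the Y-coefficient (dlt = 0) of n |-> D L_n. *)
Definition cocycle (dlt : bool) (u : int -> K) := forall m n,
  (q ^ n - q ^ m) * u (m + n) =
    (1 + q ^ m) * (q ^ n * S - (q ^ m) ^+ dlt) * u n
    - (1 + q ^ n) * (q ^ m * S - (q ^ n) ^+ dlt) * u m.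

Lemma cocycle0 dlt u n : cocycle dlt u ->
  u n * (1 + q ^ n - 2 * q ^ n * S) =
  (1 + q ^ n) * ((q ^ n) ^+ dlt - S) * u 0.
Proof.
move=> /(_ 0 n); rewrite add0r expr0z expr1n => H.
by apply: (eq_lin1 (k1 := 1) H); ring.
Qed.

(** As for [recurrence_eq0], m = 0 confines the support of u to a single value y
of q^n, where 1 + y = 2 y S. Thus if u_n <> 0 and x = q^m is neither 1 nor y nor
-1, the equation at (m, n) reduces to y S = x^dlt. For m = -n this gives y S = 1
if dlt = 0, hence y = 1, and y = -2 if dlt = 1; then m = 2 n gives -1/2 = 4. The
case y = 1 is settled apart, since u_n is reached from u_1 and u_(n-1). *)
Lemma cocycle_eq0 dlt u : cocycle dlt u -> u 0 = 0 -> forall n, u n = 0.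
Proof.
move=> cu u0.
have supp n : u n != 0 -> 1 + q ^ n = 2 * q ^ n * S.
  move=> un; apply/eqP; rewrite -subr_eq0; have /eqP := cocycle0 n cu.
  by rewrite u0 mulr0 mulf_eq0 (negbTE un).
move=> n; apply/eqP/contraT=> un; have yS := supp n un.
have y0 : q ^ n != 0 by rewrite expfz_neq0.
(* The support condition determines q ^ n, as 2 S - 1 is its inverse. *)
have uniq m : q ^ m != q ^ n -> u m = 0.
  move=> xy; apply/eqP/contraT=> /supp xS; case/eqP: xy.
  by apply: (eq_lin2 (k1 := q ^ m) (k2 := - q ^ n) yS xS); ring.
have [y1|y_neq1] := eqVneq (q ^ n) 1.
  have u1 : u 1 = 0 by apply: uniq; rewrite expr1z y1.
  have qn1 : q ^ (-1 + n) = q^-1 by rewrite expfzDr // y1 mulr1 exprN1.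
  have un1 : u (-1 + n) = 0 by apply: uniq; rewrite qn1 y1 invr_eq1.
  have /eqP := cu 1 (-1 + n); rewrite u1 un1 addrA subrr add0r !mulr0 subrr.
  rewrite qn1 mulf_eq0 (negbTE un) orbF subr_eq0 expr1z eq_sym.
  by rewrite (negbTE (neq_inv _ _ _)).
have y_neqN1 : 1 + q ^ n != 0.
  by rewrite yS !mulf_neq0 // pnatr_eq0.
have step m : q ^ m != 1 -> q ^ m != q ^ n -> 1 + q ^ m != 0 ->
    q ^ n * S = (q ^ m) ^+ dlt.
  move=> x_neq1 x_neqy x_neqN1; apply/eqP; rewrite -subr_eq0.
  have umn : u (m + n) = 0.
    apply: uniq; apply/eqP; rewrite expfzDr // => /eqP.
    by rewrite -{2}[q ^ n]mul1r (inj_eq (mulIf y0)) (negbTE x_neq1).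
  have /eqP := cu m n; rewrite (uniq m) // umn.
  rewrite !mulr0 subr0 eq_sym !mulf_eq0 (negbTE x_neqN1) (negbTE un).
  by rewrite orbF.
have yNV : q ^ n * S = (q ^ n)^-1 ^+ dlt.
  rewrite invr_expz; apply: step; rewrite -invr_expz.
  - by rewrite invr_eq1.
  - by rewrite eq_sym neq_inv.
  - by rewrite add1V_neq0.
case: dlt {cu} yNV step => [|yS1 _]; last first.
  case/eqP: y_neq1; have yS2 : q ^ n * S = 1 by [].
  by apply: (eq_lin2 (k1 := 1) (k2 := 2) yS yS2); ring.
rewrite expr1 => yS1 /(_ (n + n)); rewrite expfzDr // expr1.
have yN2 : q ^ n = - 2.
  have y2 : q ^ n * (q ^ n)^-1 = 1 by rewrite divff.
  have y_neq1' : q ^ n - 1 != 0 by rewrite subr_eq0.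
  apply: (mulfI y_neq1').
  apply: (eq_lin3 (k1 := q ^ n) (k2 := 2 * q ^ n) (k3 := 2) yS yS1 y2); ring.
rewrite yS1 yN2 => H.
have {H} : (- 2%:R)^-1 = -2 * -2 :> K.
  apply: H.
  - rewrite -subr_eq0 (_ : _ - _ = 3%:R) ?pnatr_eq0 //; ring.
  - rewrite -subr_eq0 (_ : _ - _ = 6%:R) ?pnatr_eq0 //; ring.
  - rewrite (_ : _ + _ = 5%:R) ?pnatr_eq0 //; ring.
have two0 : (2%:R : K) != 0 by rewrite pnatr_eq0.
move=> /eqP; rewrite -subr_eq0 (_ : _ - _ = 9%:R * (-2)^-1); last by field.
by rewrite mulf_eq0 invr_eq0 oppr_eq0 !pnatr_eq0.
Qed.

(** The equation at (0, 1) and (0, -1) expresses u_1 and u_(-1) through u_0, up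
to factors that may vanish. Multiplying the equation at (-1, 1) by both factors
and eliminating leaves u_0 times a nonzero multiple of (S (q - 1))^2. *)
Lemma cocycleY_eq0 u : cocycle false u -> forall n, u n = 0.
Proof.
move=> cu; apply: (cocycle_eq0 cu).
have := cu (-1) 1; have := cocycle0 1 cu; have := cocycle0 (-1) cu.
rewrite addNr !expr0 exprN1 expr1z => u_1 u1 u0.
have : - (q^-1 * (1 + q) * (q - 1) * (S * (q - 1)) ^+ 2) * u 0 = 0.
  apply: (eq_lin3 (k1 := (1 + q - 2 * S) * (1 + q - 2 * q * S))
    (k2 := (1 + q^-1) * (q - S) * (1 + q - 2 * q * S) * q)
    (k3 := - (1 + q^-1) * (1 - q * S) * (1 + q - 2 * S)) u0 u_1 u1).
  by field.
move=> /eqP; rewrite mulf_eq0 oppr_eq0 => /orP[|/eqP //].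
have q1 : q - 1 != 0 by rewrite subr_eq0.
by rewrite !mulf_eq0 invr_eq0 (negbTE q_neq0)
  (negbTE q_neqN1) (negbTE q1) (negbTE S_neq0).
Qed.

(** Here the cocycle equation alone leaves a curve of exceptional pairs (q, S),
so it is coupled with the equation of [L_m, I_n], in which d is the
I-coefficient of n |-> D I_n. If S <> 1, then d_0 = 0, and the coupled equation
at (-1, 1) and at (1, -1) yields q S = 1 and S = q unless a_0 = 0, which is
absurd. If S = 1, both a_n and d_n are - a_0 (1 + q^n) wherever q^n <> 1; the
coupled equation at (1, 1) and at (-2, 1) then gives q^2 + 4 q + 1 = 0 and
2 q^2 - q + 2 = 0 unless a_0 = 0, whence 9 q = 0. *)
Lemma cocycleX_eq0 a d : cocycle true a ->
    (forall m n, (1 - q ^ n) * d (m + n) =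
       a m * (1 - q ^ n) * (1 + q ^ n) + (1 + q ^ m) * (1 - q ^ n * S) * d n) ->
  forall n, a n = 0.
Proof.
move=> ca ad; apply: (cocycle_eq0 ca).
have q1 : 1 - q != 0 by rewrite subr_eq0 eq_sym.
have q2 : 1 - q ^ 2 != 0.
  by rewrite (_ : 1 - q ^ 2 = (1 - q) * (1 + q)) ?mulf_neq0 //
    -exprnP; ring.
have d_e n : d n * (1 + q ^ n - 2 * q ^ n * S) =
             - a 0 * (1 - q ^ n) * (1 + q ^ n).
  have := ad 0 n; rewrite add0r expr0z => H.
  by apply: (eq_lin1 (k1 := -1) H); ring.
have [S1|S_neq1] := eqVneq S 1.
  have d_eq n : 1 - q ^ n != 0 -> d n = - a 0 * (1 + q ^ n).
    move=> y1; apply: (mulfI y1).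
    by apply: (eq_lin1 (k1 := 1) (d_e n)); rewrite S1; ring.
  have a_eq n : 1 - q ^ n != 0 -> a n = - a 0 * (1 + q ^ n).
    move=> y1; apply: (mulfI y1).
    by apply: (eq_lin1 (k1 := 1) (cocycle0 n ca)); rewrite S1 expr1; ring.
  have ad1 m n : 1 - q ^ n != 0 ->
      d (m + n) = a m * (1 + q ^ n) + (1 + q ^ m) * d n.
    move=> y1; apply: (mulfI y1).
    by apply: (eq_lin1 (k1 := 1) (ad m n)); rewrite S1; ring.
  have /= := ad1 1 1.
  rewrite (d_eq 1) ?(d_eq 2) ?(a_eq 1) ?expr1z // => /(_ q1).
  rewrite -exprnP => H1.
  have /= := ad1 (-2) 1.
  have -> : -2 + 1 = -1 :> int by [].
  have qV1 : 1 - q ^ (-1) != 0 by rewrite exprN1 subr_eq0 eq_sym invr_eq1.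
  have qV2 : 1 - q ^ (-2) != 0.
    by rewrite -invr_expz subr_eq0 eq_sym invr_eq1 eq_sym -subr_eq0.
  rewrite (d_eq 1) ?(d_eq (-1)) ?(a_eq (-2)) ?expr1z // => /(_ q1).
  rewrite exprN1 -invr_expz -exprnP => H2.
  (* Twice the first quadratic condition minus the second, both times 1 + q. *)
  have : 9%:R * q * (1 + q) * a 0 = 0.
    apply: (eq_lin2 (k1 := 2 * (1 + q)) (k2 := - q ^+ 2) H1 H2); by field.
  by move/eqP; rewrite !mulf_eq0 pnatr_eq0 (negbTE q_neq0) (negbTE q_neqN1)
    => /eqP.
have S1 : 1 - S != 0 by rewrite subr_eq0 eq_sym.
have d0 : d 0 = 0.
  apply: (mulIf S1); apply: (mulfI (_ : 2 != 0)); first by rewrite pnatr_eq0.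
  by have := d_e 0; rewrite expr0z => H; apply: (eq_lin1 (k1 := 1) H); ring.
have := ad (-1) 1; have := d_e 1; have := cocycle0 (-1) ca.
rewrite addNr d0 exprN1 expr1 expr1z => a_1 d1 ad1.
have : 2 * a 0 * (1 - q) ^+ 2 * (1 + q) * S * (1 - q * S) = 0.
  apply: (eq_lin3 (k1 := - (1 + q - 2 * S) * (1 + q - 2 * q * S) * q / (1 + q))
    (k2 := - (q ^+ 2 * (1 - q) * (1 + q - 2 * q * S)))
    (k3 := - (1 - q * S) * (1 + q - 2 * S)) ad1 a_1 d1).
  by field; rewrite q_neq0.
have := ad 1 (-1); have := d_e (-1); have := cocycle0 1 ca.
rewrite subrr d0 exprN1 expr1 expr1z => a1 d_1 ad_1.
have : 2 * a 0 * (1 - q) ^+ 2 * (1 + q) * S * (q - S) = 0.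
  apply: (eq_lin3
    (k1 := - (1 + q - 2 * S) * (1 + q - 2 * q * S) * q ^+ 2 / (1 + q))
    (k2 := - (q - 1) * (1 + q - 2 * S))
    (k3 := - (q ^+ 2 * (q - S) * (1 + q - 2 * q * S))) ad_1 a1 d_1).
  by field; rewrite q_neq0.
move=> /eqP + /eqP; rewrite !mulf_eq0 /= pnatr_eq0 (negbTE q1).
rewrite (negbTE q_neqN1) (negbTE S_neq0) !orbF /=.
case: eqP => //= _; rewrite !subr_eq0 => /eqP <-.
by move=> /eqP qq; have /eqP[] := neq_inv q_neq0 q_neq1 q_neqN1;
  apply: (mulfI q_neq0); rewrite divff.
Qed.
End Recurrences.

(** * The two halves of the superalgebra *)

Section Module.
Variables (K : fieldType) (q : K).

Definition hvX (p : bool) n := if p then hvG n else hvL n.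
Definition hvY (p : bool) n := if p then hvT n else hvI n.

(** The general vector of the component of parity p and degree n; keeping both
coordinates, even when one is 0, lets vectors be compared coordinatewise. *)
Definition hvXY p n (a b : K) : hv K := << a *g hvX p n >> + << b *g hvY p n >>.

Lemma hvX_neqY p n : (hvX p n == hvY p n) = false.
Proof. by apply/eqP; case: p. Qed.

Lemma hvY_neqX p n : (hvY p n == hvX p n) = false.
Proof. by apply/eqP; case: p. Qed.

Lemma componentP p n (v : hv K) : component p n v ->
  v = hvXY p n (coeff (hvX p n) v) (coeff (hvY p n) v).
Proof.
move=> vpn; apply/eqP/freeg_eqP=> b; rewrite coeffD !coeffU.
have [/vpn [bp bn]|/coeff_outdom vb] := boolP (b \in dom v).
  have [->|->] : b = hvX p n \/ b = hvY p n.
    by case: b bp bn => k /= <- <-; [left|right|left|right].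
  - by rewrite eqxx hvY_neqX mulr1 mulr0 addr0.
  - by rewrite eqxx hvX_neqY mulr1 mulr0 add0r.
rewrite vb; case: (hvX p n =P b) => [->|_]; case: (hvY p n =P b) => [->|_];
  by rewrite ?vb ?(mul0r, mulr0) addr0.
Qed.

Lemma hvXY_inj p n a b a' b' :
  hvXY p n a b = hvXY p n a' b' -> a = a' /\ b = b'.
Proof.
move=> /eqP/freeg_eqP E; have := E (hvX p n); have := E (hvY p n).
rewrite !coeffD !coeffU !eqxx hvX_neqY hvY_neqX.
by rewrite !mulr0 !mulr1 !addr0 !add0r.
Qed.

Lemma hvXY00 p n : hvXY p n 0 0 = 0.
Proof. by rewrite /hvXY !freegU0 addr0. Qed.

Lemma hvXYD p n a b a' b' :
  hvXY p n a b + hvXY p n a' b' = hvXY p n (a + a') (b + b').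
Proof.
by apply/eqP/freeg_eqP=> c; rewrite !coeffD !coeffU; ring.
Qed.

Lemma hvXYZ p n c a b : c *: hvXY p n a b = hvXY p n (c * a) (c * b).
Proof. by rewrite /hvXY scalerDr !freegZU. Qed.

Lemma hvXYN p n a b : - hvXY p n a b = hvXY p n (- a) (- b).
Proof. by rewrite -scaleN1r hvXYZ !mulN1r. Qed.

Lemma bracket_LXY p m n c a b :
  bracket q << c *g hvL m >> (hvXY p n a b) =
  hvXY p (m + n) (c * (qnum q m - qnum q (n + p%:Z)) * a)
                 (- (c * qnum q (n + p%:Z)) * b).
Proof.
rewrite bracketDr !bracketU; case: p => /=; rewrite ?addr0 !freegZU /hvXY;
  by congr (<< _ *g _ >> + << _ *g _ >>); ring.
Qed.

Lemma bracket_IXY p m n c a b :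
  bracket q << c *g hvI m >> (hvXY p n a b) =
  hvXY p (m + n) 0 (c * qnum q m * a).
Proof.
rewrite bracketDr !bracketU; apply/eqP/freeg_eqP=> e.
by case: p; rewrite /hvXY /= ?(addrC n);
  rewrite !(coeffD, coeffZ, coeffN, coeffU, coeff0); ring.
Qed.

Lemma bracket_XYL p m n c a b :
  bracket q (hvXY p m a b) << c *g hvL n >> =
  - bracket q << c *g hvL n >> (hvXY p m a b).
Proof.
rewrite bracketDr bracketDl !bracketU opprD -!scalerN.
rewrite ![c * _]mulrC; case: p => /=; rewrite ?opprK //.
congr (_ *: _ + _).
by apply/eqP/freeg_eqP=> e; rewrite coeffN !coeffU (addrC n); ring.
Qed.

Lemma bracket_XYI p m n c a b :
  bracket q (hvXY p m a b) << c *g hvI n >> =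
  - bracket q << c *g hvI n >> (hvXY p m a b).
Proof.
rewrite bracketDr bracketDl !bracketU opprD -!scalerN.
by rewrite ![c * _]mulrC; case: p => /=; rewrite ?opprK ?oppr0.
Qed.

Lemma linearU (D : {linear hv K -> hv K}) c b :
  D << c *g b >> = c *: D << b >>.
Proof. by rewrite -[c in LHS]mulr1 -freegZU linearZ. Qed.

Lemma alphaU b :
  alpha q << b >> = << 1 + q ^ (degree b + (parity b)%:Z) *g b >> :> hv K.
Proof. by rewrite /alpha liftU scale1r. Qed.

Lemma has_parityU b : has_parity (parity b) (<< b >> : hv K).
Proof. by move=> c; rewrite domU1 inE => /eqP->. Qed.

Lemma componentU b : component (parity b) (degree b) (<< b >> : hv K).
Proof. by move=> c; rewrite domU1 inE => /eqP->. Qed.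

Lemma linear_eq0 (D : {linear hv K -> hv K}) :
  (forall b, D << b >> = 0) -> forall x, D x = 0.
Proof.
move=> D0; elim/freeg_ind_dom0 => [|c b x _ _ IHx]; first exact: raddf0.
by rewrite linearD /= IHx addr0 -[c]mulr1 -freegZU linearZ /= D0 scaler0.
Qed.

End Module.

(** * Homogeneous derivations *)

Section Derivation.
Variables (K : numFieldType) (q : K).
Hypotheses (q_neq0 : q != 0) (q_neq1 : q != 1) (q_neqN1 : 1 + q != 0).
Variables (d : bool) (s : int) (D : {linear hv K -> hv K}).
Hypothesis derD : homogeneous_alpha_derivation q 1 d s D.

Let cXX p (n : int) := coeff (hvX (p (+) d) (n + s)) (D << hvX p n >>).
Let cXY p (n : int) := coeff (hvY (p (+) d) (n + s)) (D << hvX p n >>).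
Let cYX p (n : int) := coeff (hvX (p (+) d) (n + s)) (D << hvY p n >>).
Let cYY p (n : int) := coeff (hvY (p (+) d) (n + s)) (D << hvY p n >>).

Let DX p n : D << hvX p n >> = hvXY (p (+) d) (n + s) (cXX p n) (cXY p n).
Proof.
apply/componentP; apply: (proj1 derD).
by case: p; [exact: (@componentU _ (hvG n))|exact: (@componentU _ (hvL n))].
Qed.

Let DY p n : D << hvY p n >> = hvXY (p (+) d) (n + s) (cYX p n) (cYY p n).
Proof.
apply/componentP; apply: (proj1 derD).
by case: p; [exact: (@componentU _ (hvT n))|exact: (@componentU _ (hvI n))].
Qed.

(** No sign occurs, the left argument being even: this is why the two parities
of D can be treated together. *)
Lemma derivation_even b x p : parity b = false -> has_parity p x ->
  D (bracket q << b >> x) =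
    bracket q (D << b >>) (alpha q x)
    + bracket q << 1 + q ^ degree b *g b >> (D x).
Proof.
move=> b0 xp; rewrite ((proj2 derD) false p) // => [|c]; last first.
  by rewrite -b0; apply: has_parityU.
by rewrite /= alphaU b0 addr0 mul0n expr0 scale1r.
Qed.

Let q1_neq0 : 1 - q != 0. Proof. by rewrite subr_eq0 eq_sym. Qed.

Lemma derivation_LL m n :
  let S := q ^ (s + d%:Z) in
  (q ^ n - q ^ m) * cXX false (m + n) =
    (1 + q ^ m) * (q ^ n * S - q ^ m) * cXX false n
    - (1 + q ^ n) * (q ^ m * S - q ^ n) * cXX false m /\
  (q ^ n - q ^ m) * cXY false (m + n) =
    (1 + q ^ m) * (q ^ n * S - 1) * cXY false n
    - (1 + q ^ n) * (q ^ m * S - 1) * cXY false m.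
Proof.
have := @derivation_even (hvL m) << hvL n >> false erefl
  (@has_parityU _ (hvL n)).
rewrite bracketU alphaU (DX false m) (DX false n) bracket_XYL !bracket_LXY.
rewrite mulr1 scale1r linearU (DX false (m + n)) hvXYZ hvXYN.
rewrite (addrCA n m) -addrA hvXYD => /hvXY_inj[] HX HY S.
by split; [apply: (eq_lin1 (k1 := 1 - q) HX)|apply: (eq_lin1 (k1 := 1 - q) HY)];
  rewrite /qnum -!addrA !(expfzDr _ (s + _) q_neq0) /= ?addr0 -/S; field.
Qed.

Lemma derivation_LI m n :
  let S := q ^ (s + d%:Z) in
  (q ^ n - 1) * cYX false (m + n) =
    (1 + q ^ m) * (q ^ n * S - q ^ m) * cYX false n /\
  (1 - q ^ n) * cYY false (m + n) =
    cXX false m * (1 - q ^ n) * (1 + q ^ n)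
    + (1 + q ^ m) * (1 - q ^ n * S) * cYY false n.
Proof.
have := @derivation_even (hvL m) << hvI n >> false erefl
  (@has_parityU _ (hvI n)).
rewrite bracketU alphaU (DX false m) (DY false n) bracket_XYI bracket_LXY.
rewrite bracket_IXY mulr1 scale1r linearU (DY false (m + n)) hvXYZ hvXYN.
rewrite (addrCA n m) -addrA hvXYD => /hvXY_inj[] HX HY S.
by split; [apply: (eq_lin1 (k1 := 1 - q) HX)|apply: (eq_lin1 (k1 := q - 1) HY)];
  rewrite /qnum -!addrA !(expfzDr _ (s + _) q_neq0) /= ?addr0 -/S; field.
Qed.

(** Since G_n has weight n + 1, the role of q^n is played by q q^n, and S
is shifted by the difference of the weights of the source and target halves. *)
Lemma derivation_LG m n : D << hvL m >> = 0 ->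
  let S := q ^ (s + (~~ d)%:Z - 1) in
  (q * q ^ n - q ^ m) * cXX true (m + n) =
    (1 + q ^ m) * (q * q ^ n * S - q ^ m) * cXX true n /\
  (q * q ^ n - q ^ m) * cXY true (m + n) =
    (1 + q ^ m) * (q * q ^ n * S - 1) * cXY true n.
Proof.
move=> DL0; have := @derivation_even (hvL m) << hvG n >> true erefl
  (@has_parityU _ (hvG n)).
rewrite bracketU DL0 bracket0l add0r (DX true n) bracket_LXY.
rewrite mulr1 scale1r linearU (DX true (m + n)) hvXYZ.
rewrite -addrA => /hvXY_inj[] HX HY S.
have qS : q ^ (n + s + (~~ d)%:Z) = q * q ^ n * S.
  by rewrite /S !expfzDr // exprN1; field.
by split; [apply: (eq_lin1 (k1 := 1 - q) HX)|apply: (eq_lin1 (k1 := 1 - q) HY)];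
  rewrite /qnum /= qS (expfzDr n 1 q_neq0) expr1z; field.
Qed.

(** The bracket [I_1, G_(n-1)] equals T_n exactly because {1} = 1. *)
Lemma derivation_IG n : D << hvI 1 >> = 0 -> D << hvG (n - 1) >> = 0 ->
  D << hvT n >> = 0.
Proof.
move=> DI0 DG0; have := @derivation_even (hvI 1) << hvG (n - 1) >> true erefl
  (@has_parityU _ (hvG (n - 1))).
rewrite bracketU DI0 bracket0l DG0 bracket0r addr0 mulr1 scale1r linearU.
by rewrite /qnum expr1z (divff q1_neq0) scale1r addrC subrK.
Qed.

(** The order matters: the coupled equation for a must be used before the
I-coefficients of the D I_n obey a homogeneous recurrence, and D must be known
to vanish on the L_n and I_n before [L_m, G_n] and [I_m, G_n] give
equations on D G_n and D T_n alone. *)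
Lemma homogeneous_derivation_eq0 x : D x = 0.
Proof.
have S_neq0 k : q ^ k != 0 by rewrite expfz_neq0.
have LL m n := derivation_LL m n; have LI m n := derivation_LI m n.
have a0 : forall n, cXX false n = 0.
  apply: (cocycleX_eq0 (S := q ^ (s + d%:Z)) q_neq0 q_neq1 q_neqN1 (S_neq0 _)
    (d := cYY false)) => // m n.
  - by rewrite !expr1; case: (LL m n).
  - by case: (LI m n).
have b0 : forall n, cXY false n = 0.
  apply: (cocycleY_eq0 (S := q ^ (s + d%:Z)) q_neq0 q_neq1 q_neqN1 (S_neq0 _)).
  move=> m n.
  by rewrite !expr0; case: (LL m n).
have c0 : forall n, cYX false n = 0.
  apply: (recurrence_eq0 (S := q ^ (s + d%:Z)) q_neq0 q_neq1 q_neqN1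
    (t := 1) (eps := false) (dlt := true)) => [|m n].
    exact: oner_neq0.
  by rewrite !mul1r expr0 expr1; case: (LI m n).
have d0 : forall n, cYY false n = 0.
  apply: (recurrence_eq0 (S := q ^ (s + d%:Z)) q_neq0 q_neq1 q_neqN1
    (t := 1) (eps := false) (dlt := false)) => [|m n].
    exact: oner_neq0.
  have [_ H] := LI m n; rewrite a0 in H.
  by rewrite !mul1r expr0; apply: (eq_lin1 (k1 := -1) H); ring.
have DL n : D << hvL n >> = 0 by rewrite (DX false n) a0 b0 hvXY00.
have DI n : D << hvI n >> = 0 by rewrite (DY false n) c0 d0 hvXY00.
have LG m n := @derivation_LG m n (DL m).
have e0 : forall n, cXX true n = 0.
  apply: (recurrence_eq0 (S := q ^ (s + (~~ d)%:Z - 1)) q_neq0 q_neq1 q_neqN1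
    (t := q) (eps := true) (dlt := true)) => // m n.
  by rewrite expr1; case: (LG m n).
have f0 : forall n, cXY true n = 0.
  apply: (recurrence_eq0 (S := q ^ (s + (~~ d)%:Z - 1)) q_neq0 q_neq1 q_neqN1
    (t := q) (eps := true) (dlt := false)) => // m n.
  by rewrite expr1 expr0; case: (LG m n).
have DG n : D << hvG n >> = 0 by rewrite (DX true n) e0 f0 hvXY00.
by apply: linear_eq0; case=> n //; apply: derivation_IG.
Qed.
End Derivation.

(** * The vanishing theorem *)

Theorem proposition3p3 (R : realType) (q : R[i])
    (q_neq0 : q != 0) (q_neq1 : q != 1) (q_neqN1 : q != -1)
    (D : {linear hv R[i] -> hv R[i]}) :
  alpha_derivation q 1 D -> forall x : hv R[i], D x = 0.
Proof.
have qN1 : 1 + q != 0 by rewrite addrC addr_eq0.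
move=> [r [Dc [_ derDc DE]]] x; rewrite DE big_seq big1 // => c /derDc derc.
exact: (homogeneous_derivation_eq0 q_neq0 q_neq1 qN1 derc).
Qed.
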